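(* The Takagi function $T:\mathbb{R}\to\mathbb{R}$, $T(x)=\sum_{k=1}^{\infty} g_k(x)$ with $g_k(x)=\min\{|x-y| : y\in D_k\}$ and $D_k=\{j2^{-k}: j\in\mathbb{Z}\}$, is nowhere approximately derivable; that is, there is no point $x\in\mathbb{R}$ at which $T$ is approximately derivable.
   Context: $\mathcal{L}$ denotes the Lebesgue measure on $\mathbb{R}$. For $f:\mathbb{R}\to\mathbb{R}$ (possibly undefined at $x$ itself), $\ell\in\mathbb{R}$ is the approximate limit of $f$ at $x$, written $\mathrm{ap\,lim}_{y\to x} f(y)=\ell$, if for every $\varepsilon>0$, $\lim_{r\to 0^+}\frac{\mathcal{L}\left((x-r,x+r)\cap\{y\in\mathbb{R}: |f(y)-\ell|\ge\varepsilon\}\right)}{2r}=0$. A function $f:\mathbb{R}\to\mathbb{R}$ is approximately derivable at $x$ if there exists a real number $f'_{ap}(x)$ such that $\mathrm{ap\,lim}_{y\to x}\frac{f(y)-f(x)-f'_{ap}(x)(y-x)}{y-x}=0$. *)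

(* Defs.v *)
From HB Require Import structures.
From mathcomp Require Import all_boot all_order all_algebra.
From mathcomp Require Import ring lra.
From mathcomp Require Import all_classical all_reals all_analysis.
Set Implicit Arguments.
Unset Strict Implicit.
Unset Printing Implicit Defensive.
Import Order.TTheory GRing.Theory Num.Theory.
Import numFieldNormedType.Exports.
Local Open Scope classical_set_scope.
Local Open Scope ring_scope.

(* The exceptional set excludes [x], since [f] need not be defined there (the
   difference quotients below take the value [0 / 0 = 0] at [x]). On a set that
   is not measurable, [lebesgue_measure] is the Lebesgue outer measure. *)
Definition is_ap_lim (R : realType) (f : R -> R) (x l : R) : Prop :=
  forall e : R, 0 < e ->
    (lebesgue_measure (`]x - r, x + r[ `&`
                       [set y | y != x /\ e <= `|f y - l|])%R / (2 * r)%:E)%E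
      @[r --> 0^'+] --> 0%E.

Definition ap_derivable (R : realType) (f : R -> R) (x : R) : Prop :=
  exists d : R, is_ap_lim (fun y => (f y - f x - d * (y - x)) / (y - x)) x 0.

Definition dyadic (R : realType) (k : nat) : set R :=
  [set j%:~R * 2 ^- k | j in [set: int]].
Arguments dyadic : clear implicits.

Definition takagi_term (R : realType) (k : nat) (x : R) : R :=
  inf [set `|x - y| | y in dyadic R k].

(* The infimum above is a minimum. *)
Lemma takagi_term_min (R : realType) (k : nat) (x : R) :
  (exists2 y, dyadic R k y & takagi_term k x = `|x - y|) /\
  (forall y, dyadic R k y -> takagi_term k x <= `|x - y|).
Proof.
have c0 : 0 < 2 ^- k :> R by rewrite invr_gt0 exprn_gt0.
pose c : R := 2 ^- k; pose n := Num.floor (x / c).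
have lex : n%:~R * c <= x by rewrite -ler_pdivlMr// floor_le.
have gex : x <= (n + 1)%:~R * c.
  by rewrite -ler_pdivrMr// ltW// floorD1_gt.
pose m := if `|x - n%:~R * c| <= `|x - (n + 1)%:~R * c| then n else n + 1.
have mP y : dyadic R k y -> `|x - m%:~R * c| <= `|x - y|.
  move=> [j _ <-]; rewrite -/c.
  have [jn|nj] := lerP j n.
    have : `|x - n%:~R * c| <= `|x - j%:~R * c|.
      have h : j%:~R * c <= n%:~R * c by rewrite ler_pM2r// ler_int.
      rewrite !ger0_norm ?subr_ge0//; first by rewrite lerD2l lerN2.
      exact: le_trans h lex.
    rewrite /m; case: ifPn => // /negbTE; case: leP => // /ltW lt _.
    exact: le_trans.
  have : `|x - (n + 1)%:~R * c| <= `|x - j%:~R * c|.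
    have h : (n + 1)%:~R * c <= j%:~R * c by rewrite ler_pM2r// ler_int lezD1.
    rewrite !ler0_norm ?subr_le0//; first by rewrite lerN2 lerD2l lerN2.
    exact: le_trans gex h.
  by rewrite /m; case: ifP => // le; exact: le_trans.
have mD : dyadic R k (m%:~R * c) by exists m.
have E : takagi_term k x = `|x - m%:~R * c|.
  apply/eqP; rewrite eq_le; apply/andP; split.
    by apply: ge_inf; [exists 0 => _ [y _ <-] | exists (m%:~R * c)].
  apply: lb_le_inf; first by exists `|x - m%:~R * c|, (m%:~R * c).
  by move=> _ [y yD <-]; exact: mP.
by split; [exists (m%:~R * c) | move=> y yD; rewrite E; exact: mP].
Qed.

Definition takagi (R : realType) (x : R) : R :=
  limn (fun n => \sum_(1 <= k < n.+1) takagi_term k x).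

(* The limit defining [takagi] exists. *)
Lemma is_cvg_takagi (R : realType) (x : R) :
  cvgn (fun n => \sum_(1 <= k < n.+1) takagi_term k x).
Proof.
have t0 k : 0 <= takagi_term k x.
  by have [[y _ ->] _] := takagi_term_min k x.
have t1 k : takagi_term k x <= 2 ^- k.
  have c0 : 0 < 2 ^- k :> R by rewrite invr_gt0 exprn_gt0.
  pose n := Num.floor (x / 2 ^- k).
  have [_ /(_ (n%:~R * 2 ^- k))] := takagi_term_min k x.
  move=> /(_ (ex_intro2 _ _ n I erefl)) /le_trans; apply.
  have lex : n%:~R * 2 ^- k <= x by rewrite -ler_pdivlMr// floor_le.
  rewrite ger0_norm ?subr_ge0// lerBlDl -{2}[2 ^- k]mul1r -mulrDl.
  by rewrite -ler_pdivrMr// ltW// -(intrD _ n 1) floorD1_gt.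
apply: nondecreasing_is_cvgn.
  by apply/nondecreasing_seqP => n; rewrite [leRHS]big_nat_recr//= lerDl.
exists 1 => _ [n _ <-].
suff : \sum_(1 <= k < n.+1) takagi_term k x <= 1 - 2 ^- n.
  by move=> /le_trans; apply; rewrite gerBl invr_ge0 exprn_ge0.
elim: n => [|n ih]; first by rewrite big_geq// expr0 invr1 subrr.
rewrite big_nat_recr//=; apply: le_trans (lerD ih (t1 _)) _.
rewrite exprS invfM; set a := _ ^-1; have := splitr (2 ^- n : R); lra.
Qed.

(* Main.v *)
(* On a dyadic interval of length 2^-n / 2, parametrized by s in [0, 1/2], the
   function takagi is an affine function of s plus 2^-n * takagi s. If takagi
   were approximately derivable at x, then on the dyadic interval containing x
   it would be, for n large, within a small multiple of 2^-n of an affine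
   function outside a set of small relative measure. Now t + (1/2 - t) is equal
   to t/2 + (1/2 - t/2), and takagi is symmetric about 1/4, so the combination
   of its values at these four points with signs +, +, -, - cancels the affine
   part and leaves 2 (takagi t - takagi (t/2)) >= t. Hence for each t in
   ]1/16, 1/8[ one of the four corresponding points is exceptional, and the
   exceptional set has relative measure at least 1/96. *)
Require Import Defs.
From mathcomp Require Import all_boot all_order all_algebra.
From mathcomp Require Import ring lra.
From mathcomp Require Import all_classical all_reals all_analysis.
From mathcomp Require Import measurable_realfun.
Set Implicit Arguments.
Unset Strict Implicit.
Unset Printing Implicit Defensive.
Import Order.TTheory GRing.Theory Num.Theory.
Import numFieldNormedType.Exports.
Local Open Scope classical_set_scope.
Local Open Scope ring_scope.

(** * Distances to the dyadic grids *)

Lemma takagi_term_ge0 (R : realType) (k : nat) (x : R) : 0 <= takagi_term k x.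
Proof. by have [[y _ ->] _] := takagi_term_min k x. Qed.

Lemma takagi_term_dist (R : realType) (k : nat) (x y : R) :
  `|takagi_term k x - takagi_term k y| <= `|x - y|.
Proof.
have H (u v : R) : takagi_term k u - takagi_term k v <= `|u - v|.
  have [[z kz ->] _] := takagi_term_min k v.
  have [_ /(_ z kz) uz] := takagi_term_min k u.
  rewrite lerBlDr (le_trans uz)//.
  by rewrite (le_trans _ (ler_normD _ _))// subrKA.
by rewrite ler_norml H lerNl opprB distrC H.
Qed.

(** A nearest point of the first grid is sent to a point of the second, and this bounds the second
    distance. The symmetries and the scaling below follow by using it in both directions. *)
Lemma takagi_term_le_map (R : realType) (k l : nat) (c x x' : R) :
  (forall y, dyadic R k y -> exists2 z, dyadic R l z & `|x' - z| = c * `|x - y|) ->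
  takagi_term l x' <= c * takagi_term k x.
Proof.
move=> H; have [[y ky ->] _] := takagi_term_min k x.
by have [z lz <-] := H y ky; have [_ ->] := takagi_term_min l x'.
Qed.

Lemma takagi_termN (R : realType) (k : nat) (x : R) :
  takagi_term k (- x) = takagi_term k x.
Proof.
have dN (u : R) : takagi_term k (- u) <= takagi_term k u.
  rewrite -[leRHS]mul1r; apply: takagi_term_le_map => _ [j _ <-].
  exists ((- j)%:~R * 2 ^- k); first by exists (- j).
  by rewrite mulrNz mulNr -opprD normrN mul1r.
by apply/eqP; rewrite eq_le dN -{1}(opprK x) dN.
Qed.

Lemma takagi_term_double (R : realType) (k : nat) (x : R) :
  takagi_term k.+1 x = 2^-1 * takagi_term k (2 * x).
Proof.
have E j : j%:~R * 2 ^- k = 2 * (j%:~R * 2 ^- k.+1) :> R.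
  by rewrite exprS invfM mulrCA mulVKf.
have En (y : R) : `|2 * x - 2 * y| = 2 * `|x - y|.
  by rewrite -mulrBr normrM ger0_norm.
apply/eqP; rewrite eq_le; apply/andP; split.
  apply: takagi_term_le_map => _ [j _ <-]; exists (j%:~R * 2 ^- k.+1).
    by exists j.
  by rewrite E En mulKf.
rewrite ler_pdivrMl//.
apply: takagi_term_le_map => _ [j _ <-]; exists (j%:~R * 2 ^- k).
  by exists j.
by rewrite E En.
Qed.

(** [2^-1] is the point of index [2 ^+ k] of the grid of level [k.+1]. Level [0], the integers,
    lacks this period. *)
Lemma takagi_termD_half (R : realType) (k : nat) (x : R) :
  takagi_term k.+1 (x + 2^-1) = takagi_term k.+1 x.
Proof.
have E : (2 ^+ k)%:~R * 2 ^- k.+1 = 2^-1 :> R.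
  by rewrite exprS invfM rmorphXn mulrCA mulfV ?mulr1//= expf_neq0//.
apply/eqP; rewrite eq_le; apply/andP; split; rewrite -[leRHS]mul1r.
  apply: takagi_term_le_map => _ [j _ <-].
  exists ((j + 2 ^+ k)%:~R * 2 ^- k.+1); first by exists (j + 2 ^+ k).
  by rewrite intrD mulrDl E mul1r opprD addrACA subrr addr0.
apply: takagi_term_le_map => _ [j _ <-].
exists ((j - 2 ^+ k)%:~R * 2 ^- k.+1); first by exists (j - 2 ^+ k).
by rewrite intrB mulrBl E mul1r; congr `|_|; ring.
Qed.

(** Among the multiples of 1/2, a nearest one to such an [x] is 0. *)
Lemma takagi_term1_id (R : realType) (x : R) :
  0 <= x <= 4^-1 -> takagi_term 1 x = x.
Proof.
move=> /andP[x0 x4]; have [[y [j _ <-]] e le] := takagi_term_min 1 x.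
have j0 : dyadic R 1 0 by exists 0 => //; rewrite mul0r.
apply/eqP; rewrite eq_le; apply/andP; split.
  by have := le _ j0; rewrite subr0 ger0_norm.
rewrite e expr1.
have [j1|j1] := lerP 1 j.
  have : (1 : R) <= j%:~R by rewrite -(ler_int R) in j1.
  by move=> ?; rewrite ler0_norm; lra.
have : j%:~R <= (0 : R) by rewrite -[0]/(0%:~R) ler_int -ltzD1.
by move=> ?; rewrite ger0_norm; lra.
Qed.

(** * Functional equations of the Takagi function *)

Lemma takagi_cvg (R : realType) (x : R) :
  (fun n => \sum_(1 <= k < n.+1) takagi_term k x) @ \oo --> takagi x.
Proof. exact: is_cvg_takagi. Qed.

Lemma takagi_ge0 (R : realType) (x : R) : 0 <= takagi x.
Proof.
apply: limr_ge (@is_cvg_takagi R x) _.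
by apply: nearW => n; apply: sumr_ge0 => k _; exact: takagi_term_ge0.
Qed.

Lemma takagiN (R : realType) (x : R) : takagi (- x) = takagi x.
Proof.
rewrite /takagi; congr (limn _); apply/funext => n.
by apply: eq_bigr => k _; exact: takagi_termN.
Qed.

Lemma takagiD_half (R : realType) (x : R) : takagi (x + 2^-1) = takagi x.
Proof.
rewrite /takagi; congr (limn _); apply/funext => n.
by apply: eq_big_nat => -[//|k] _; exact: takagi_termD_half.
Qed.

Lemma takagi_half_sub (R : realType) (x : R) : takagi (2^-1 - x) = takagi x.
Proof. by rewrite addrC takagiD_half takagiN. Qed.

(** By [takagi_term_double], the terms from the second on are half the terms of the series at
    [2 * x]. *)
Lemma takagiE (R : realType) (x : R) :
  takagi x = takagi_term 1 x + 2^-1 * takagi (2 * x).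
Proof.
have H : (fun n => \sum_(1 <= k < n.+2) takagi_term k x) @ \oo -->
    takagi_term 1 x + 2^-1 * takagi (2 * x).
  rewrite [X in X @ _ --> _](_ : _ = (fun n => takagi_term 1 x +
    2^-1 * \sum_(1 <= k < n.+1) takagi_term k (2 * x))).
    by apply: cvgD; [exact: cvg_cst|apply: cvgMl_tmp; exact: takagi_cvg].
  apply/funext => n; rewrite big_nat_recl//= mulr_sumr; congr (_ + _).
  by apply: eq_bigr => k _; exact: takagi_term_double.
have H' := takagi_cvg (x := x).
rewrite -cvg_shiftS in H'.
exact: cvg_unique H' H.
Qed.

Lemma takagi_small (R : realType) (x : R) :
  0 <= x <= 4^-1 -> takagi x = x + 2^-1 * takagi (2 * x).
Proof. by move=> x4; rewrite takagiE takagi_term1_id. Qed.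

(** Induction on [n]: the interval of index [j] is a half of the parent interval of index [j %/ 2],
    on which the parameter is [s / 2] or [4^-1 + s / 2]. The self-similarity of [takagi] then adds
    an affine term and halves the coefficient of [takagi s]. *)
Lemma takagi_dyadic_affine (R : realType) (n : nat) (j : int) :
  exists A B : R, forall s, 0 <= s <= 2^-1 ->
    takagi ((j%:~R / 2 + s) * 2 ^- n) = A + B * s + 2 ^- n * takagi s.
Proof.
elim: n j => [|n IH] j.
  exists 0, 0 => s _; rewrite expr0 invr1 mulr1 mul0r !add0r mul1r addrC.
  (* Multiples of 1/2 are periods; for negative [j] the period is applied at the shifted point. *)
  have P (m : nat) (t : R) : takagi (t + m%:R / 2) = takagi t.
    elim: m t => [|m ih] t; first by rewrite mul0r addr0.
    by rewrite -natr1 mulrDl mul1r addrA takagiD_half.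
  case: j => m; first exact: P.
  by rewrite NegzE mulrNz -pmulrn mulNr -[LHS](@P m.+1) addrNK.
pose i := (j %/ 2)%Z; have := divz_eq j 2; rewrite -/i.
have [A [B AB]] := IH i.
have hE (t : R) : t * 2 ^- n.+1 = (t / 2) * 2 ^- n.
  by rewrite exprS invfM mulrA.
have [jb|jb] : (j %% 2)%Z = 0 \/ (j %% 2)%Z = 1.
- have := modz_ge0 j (isT : 2 != 0 :> int).
  have := ltz_pmod j (isT : 0 < 2 :> int).
  by case: (j %% 2)%Z => [[|[|]]|]//; [left|right].
- rewrite jb addr0 => jE; exists A, (B / 2 + 2 ^- n / 2) => s s2.
  rewrite hE jE intrM.
  have -> : (i%:~R * 2%:~R / 2 + s) / 2 = i%:~R / 2 + s / 2 :> R by field.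
  rewrite AB; last by lra.
  rewrite [takagi (s / 2)]takagi_small; last by lra.
  have -> : 2 * (s / 2) = s :> R by field.
  by rewrite exprS invfM; ring.
(* In the right half, reflection about 1/4 sends [4^-1 + s / 2] to [4^-1 - s / 2], where
   [takagi_small] applies. *)
- rewrite jb => jE; exists (A + B / 4 + 2 ^- n / 4), (B / 2 - 2 ^- n / 2) => s s2.
  rewrite hE jE intrD intrM.
  have -> : ((i%:~R * 2%:~R + 1%:~R) / 2 + s) / 2 = i%:~R / 2 + (4^-1 + s / 2) :> R.
    by field.
  rewrite AB; last by lra.
  rewrite -takagi_half_sub takagi_small; last by lra.
  have -> : 2 * (2^-1 - (4^-1 + s / 2)) = 2^-1 - s :> R by field.
  by rewrite takagi_half_sub exprS invfM; field.
Qed.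

(** Unfolding at [t / 2] turns the difference into [(takagi t - t) / 2]; unfolding at [t] and
    [2 * t] gives [takagi t >= 2 * t]. All three points lie below 1/4 because [t < 8^-1]. *)
Lemma takagi_defect (R : realType) (t : R) : 16^-1 < t < 8^-1 ->
  t / 2 <= takagi t - takagi (t / 2).
Proof.
move=> t8.
have := @takagi_small R (t / 2); have := @takagi_small R t.
have := @takagi_small R (2 * t); have := takagi_ge0 (2 * (2 * t)).
have -> : 2 * (t / 2) = t by field.
by move=> ? -> ; [move=> -> ; [move=> -> |] |]; lra.
Qed.

(** * Measurability and affine changes of variable *)

Lemma takagi_measurable (R : realType) : measurable_fun setT (@takagi R).
Proof.
apply: (measurable_fun_cvg
  (h := fun n x => \sum_(1 <= k < n.+1) takagi_term k x)) => [n|x _].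
  elim: n => [|n IH].
    rewrite [X in measurable_fun _ X](_ : _ = cst 0)//.
    by apply/funext => x; rewrite big_geq.
  rewrite [X in measurable_fun _ X](_ : _ = (fun x =>
      \sum_(1 <= k < n.+1) takagi_term k x + takagi_term n.+1 x)); last first.
    by apply/funext => x; rewrite big_nat_recr.
  apply: measurable_funD => //; apply: continuous_measurable_fun => x.
  apply/cvgrPdist_lt => e e0; near=> y.
  apply: le_lt_trans (takagi_term_dist _ _ _) _.
  by near: y; exact: (@cvgr_dist_lt _ R^o _ _ _ id x).
exact: takagi_cvg.
Unshelve. all: by end_near. Qed.

(** The pushforward of Lebesgue measure under the affine map, scaled by [|c|], gives half-open
    intervals their length, so uniqueness identifies it with Lebesgue measure. *)
Lemma lebesgue_measure_affine (R : realType) (a c : R) (A : set R) :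
  c != 0 -> measurable A ->
  (`|c|%:E * lebesgue_measure ((fun t : R => a + c * t)%R @^-1` A) =
   lebesgue_measure A)%E.
Proof.
move=> c0 mA; pose f := (fun t : R => a + c * t : measurableTypeR R).
have mf : measurable_fun [set: measurableTypeR R] f.
  by apply: measurable_funD => //; apply: measurable_funM.
pose push := measure_function_pushforward__canonical__measure_function_Measure
  (@lebesgue_measure R) mf.
apply/esym; rewrite (@lebesgue_measure_unique R
  (mscale (NngNum (normr_ge0 c)) push)) => // _ [[u v] _ <-].
rewrite [RHS](_ : _ = `|c|%:E * lebesgue_measure (f @^-1` `]u, v]))%E//.
have [c_gt0|c_lt0|/eqP] := ltgtP 0 c; last by rewrite eq_sym (negbTE c0).
- have -> : f @^-1` `]u, v] = `](u - a) / c, (v - a) / c]%classic.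
    apply/seteqP; split=> t /=; rewrite !in_itv/= /f ltr_pdivrMr// ler_pdivlMr//;
      by move=> /andP[? ?]; apply/andP; split; lra.
  rewrite !lebesgue_measure_itv/= !lte_fin ltr_pM2r ?invr_gt0// ltrD2r.
  case: ifP => _; last by rewrite mule0.
  by rewrite -!EFinB -EFinM gtr0_norm//; congr EFin; field.
(* A negative slope swaps the open and the closed end. *)
- have -> : f @^-1` `]u, v] = `[(v - a) / c, (u - a) / c[%classic.
    apply/seteqP; split=> t /=; rewrite !in_itv/= /f ler_ndivrMr// ltr_ndivlMr//;
      by move=> /andP[? ?]; apply/andP; split; lra.
  rewrite !lebesgue_measure_itv/= !lte_fin ltr_nM2r ?invr_lt0// ltrD2r.
  case: ifP => _; last by rewrite mule0.
  by rewrite -!EFinB -EFinM ltr0_norm//; congr EFin; field.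
Qed.

Lemma lebesgue_measure_affine_preimage (R : realType) (a c : R) (A : set R) :
  c != 0 -> measurable A ->
  (lebesgue_measure ((fun t : R => a + c * t)%R @^-1` A) =
   (`|c|^-1)%:E * lebesgue_measure A)%E.
Proof.
move=> c0 mA; rewrite -(lebesgue_measure_affine a c0 mA) muleA -EFinM.
by rewrite mulVf ?normr_eq0// mul1e.
Qed.

(** * Lower bound for the exceptional set *)

(* The exceptional set of [is_ap_lim] for the slope [d], with [e = 1/32] and the
   division by [y - x] cleared. *)
Definition takagi_bad (R : realType) (x d r : R) : set R :=
  `]x - r, x + r[ `&` [set y | y != x /\
     32^-1 * `|y - x| <= `|takagi y - takagi x - d * (y - x)|].

Lemma measurable_takagi_bad (R : realType) (x d r : R) :
  measurable (takagi_bad x d r).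
Proof.
apply: measurableI; first exact: measurable_itv.
rewrite [X in measurable X](_ : _ = ~` [set x] `&` [set y |
     32^-1 * `|y - x| <= `|takagi y - takagi x - d * (y - x)|]); last first.
  by apply/seteqP; split=> y /= [/eqP ? ?]; split=> //; apply/eqP.
apply: measurableI; first exact: measurableC.
rewrite [X in measurable X](_ : _ = [set: R] `&` (fun y =>
    `|takagi y - takagi x - d * (y - x)| - 32^-1 * `|y - x|) @^-1` `[0, +oo[).
  have mB : measurable_fun [set: R] (fun y => y - x) by exact: measurable_funB.
  suff : measurable_fun [set: R] (fun y =>
    `|takagi y - takagi x - d * (y - x)| - 32^-1 * `|y - x|).
    by move=> mf; apply: mf => //; exact: measurable_itv.
  apply: measurable_funB; last first.
    by apply: measurable_funM => //; exact: measurableT_comp.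
  apply: measurableT_comp => //; apply: measurable_funB.
    by apply: measurable_funB => //; exact: takagi_measurable.
  exact: measurable_funM.
by rewrite setTI; apply/seteqP; split=> y /=; rewrite in_itv/= andbT subr_ge0.
Qed.

(** The four points are [(p + s) * h] with [h = 2 ^- n] and [s] equal to [t], [2^-1 - t], [t / 2]
    and [2^-1 - t / 2], written as affine maps of [t] so that preimages can be measured. *)
Lemma takagi_bad_cover (R : realType) (x d : R) (n : nat) :
  exists p : R, forall t, 16^-1 < t < 8^-1 ->
    let B := takagi_bad x d (2 ^- n / 2) in
    [\/ B (p * 2 ^- n + 2 ^- n * t),
        B ((p + 2^-1) * 2 ^- n + - 2 ^- n * t),
        B (p * 2 ^- n + (2 ^- n / 2) * t) |
        B ((p + 2^-1) * 2 ^- n + - (2 ^- n / 2) * t)].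
Proof.
have h0 : 0 < 2 ^- n :> R by rewrite invr_gt0 exprn_gt0.
set h : R := 2 ^- n in h0 *.
pose j := Num.floor (x / h * 2).
have jx1 : j%:~R / 2 * h <= x.
  by rewrite -ler_pdivlMr// ler_pdivrMr// floor_le.
have jx2 : x < (j%:~R / 2 + 2^-1) * h.
  rewrite -ltr_pdivrMr//; have := floorD1_gt (x / h * 2).
  by rewrite -/j intrD; lra.
have [A [C TA]] := takagi_dyadic_affine R n j; rewrite -/h in TA.
exists (j%:~R / 2) => t t8 B.
set p := j%:~R / 2 in jx1 jx2 TA *.
pose E y := takagi y - takagi x - d * (y - x).
(* Both [x] and the point lie in one interval of length [h / 2], so the tolerance is at most
   [h / 64]. The point [x] itself is never exceptional, but its error is 0. *)
have good s : 0 < s < 2^-1 -> ~ B ((p + s) * h) -> `|E ((p + s) * h)| <= h / 64.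
  move=> /andP[s0 s2] nB; set y := (p + s) * h in nB *.
  have sh0 : 0 < s * h by rewrite mulr_gt0.
  have sh2 : s * h < 2^-1 * h by rewrite ltr_pM2r.
  have yx : `|y - x| < h / 2 by rewrite ltr_norml /y; lra.
  have [->|/eqP ynx] := eqVneq y x.
    by rewrite /E !subrr mulr0 subr0 normr0; lra.
  rewrite leNgt; apply/negP => hE; apply: nB; split => /=.
    by rewrite in_itv/= -ltr_distl.
  by split; [exact/eqP|rewrite -/(E y); lra].
have [B1|nB1] := pselect (B ((p + t) * h)).
  by apply: Or41; rewrite [X in B X](_ : _ = (p + t) * h)//; field.
have [B2|nB2] := pselect (B ((p + (2^-1 - t)) * h)).
  by apply: Or42; rewrite [X in B X](_ : _ = (p + (2^-1 - t)) * h)//; field.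
have [B3|nB3] := pselect (B ((p + t / 2) * h)).
  by apply: Or43; rewrite [X in B X](_ : _ = (p + t / 2) * h)//; field.
have [B4|nB4] := pselect (B ((p + (2^-1 - t / 2)) * h)).
  by apply: Or44; rewrite [X in B X](_ : _ = (p + (2^-1 - t / 2)) * h)//; field.
exfalso.
have := good _ _ nB1; have := good _ _ nB2.
have := good _ _ nB3; have := good _ _ nB4.
rewrite /E !TA ?takagi_half_sub; try lra.
do 4 (move=> /(_ ltac:(lra)); rewrite ler_norml => /andP[? ?]).
(* The signed sum of the four errors is twice the right-hand side, hence at least [h * t > h / 16],
   against the bound [4 * (h / 64)]. *)
have : h * (t / 2) <= h * (takagi t - takagi (t / 2)).
  by rewrite ler_pM2l// takagi_defect.
have : h * 16^-1 < h * t by rewrite ltr_pM2l//; lra.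
lra.
Qed.

(** An interval of length 1/16 is covered by four preimages of the exceptional set. If that set has
    measure [m], slopes of size [h], [h], [h / 2], [h / 2] give them total measure [6 * m / h],
    whence [m >= h / 96]. *)
Lemma takagi_bad_measure (R : realType) (x d : R) (n : nat) :
  ((2 ^- n / 96)%:E <= lebesgue_measure (takagi_bad x d (2 ^- n / 2)))%E.
Proof.
have [p cover] := takagi_bad_cover x d n; cbv zeta in cover.
have h0 : 0 < 2 ^- n :> R by rewrite invr_gt0 exprn_gt0.
set h : R := 2 ^- n in h0 cover *; have hN0 : h != 0 by rewrite gt_eqF.
set B := takagi_bad x d (h / 2) in cover *.
have mB : measurable B by exact: measurable_takagi_bad.
pose f (a c : R) := (fun t : R => a + c * t) @^-1` B.
have mf a c : measurable (f a c).
  rewrite -[f a c]setTI; suff : measurable_fun [set: R] (fun t => a + c * t).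
    by apply.
  by apply: measurable_funD => //; exact: measurable_funM.
(* Finiteness allows the final estimate to be carried out in [R]. *)
have Bfin : lebesgue_measure B \is a fin_num.
  rewrite ge0_fin_numE//; apply: (@le_lt_trans _ _
    (lebesgue_measure (`](x - h / 2)%R, (x + h / 2)%R[ : set R))).
    by apply: le_measure; rewrite ?inE//; exact: subIsetl.
  by rewrite lebesgue_measure_itv/=; case: ifP => // _; rewrite ltry.
have fE a c : c != 0 ->
    lebesgue_measure (f a c) = (`|c|^-1 * fine (lebesgue_measure B))%:E.
  by move=> c0; rewrite lebesgue_measure_affine_preimage// EFinM fineK.
pose I : set R := `]16^-1, 8^-1[%classic.
have muI : lebesgue_measure I = (16^-1)%:E.
  by rewrite lebesgue_measure_itv/= lte_fin ifT -?EFinB; [congr EFin; lra|lra].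
have : (lebesgue_measure I <=
    lebesgue_measure (f (p * h)%R h `|` f ((p + 2^-1) * h)%R (- h)%R `|`
      f (p * h)%R (h / 2)%R `|` f ((p + 2^-1) * h)%R (- (h / 2))%R))%E.
  apply: le_measure; rewrite ?inE; first exact: measurable_itv.
    exact: measurableU _ _ (measurableU _ _ (measurableU _ _ (mf _ _) (mf _ _))
      (mf _ _)) (mf _ _).
  move=> t; rewrite /I /= in_itv/= => /cover [] Bt;
    by [do 3 left|do 2 left; right|left; right|right].
rewrite muI => /le_trans le16.
have sub4 (A1 A2 A3 A4 : set R) : measurable A1 -> measurable A2 ->
    measurable A3 -> measurable A4 ->
    (lebesgue_measure (A1 `|` A2 `|` A3 `|` A4) <= lebesgue_measure A1 +
      lebesgue_measure A2 + lebesgue_measure A3 + lebesgue_measure A4)%E.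
  move=> m1 m2 m3 m4; have m12 := measurableU _ _ m1 m2.
  have m123 := measurableU _ _ m12 m3.
  apply: (le_trans (measureU2 _ _ _)) => //; apply: leeD => //.
  apply: (le_trans (measureU2 _ _ _)) => //; apply: leeD => //.
  exact: measureU2.
have {le16} := le16 _ (sub4 _ _ _ _ (mf _ _) (mf _ _) (mf _ _) (mf _ _)).
have h2N0 : h / 2 != 0 by rewrite mulf_neq0// invr_eq0.
rewrite !fE ?oppr_eq0// !normrN !gtr0_norm//; last by rewrite divr_gt0.
rewrite -!EFinD lee_fin -[in X in _ -> X](fineK Bfin) lee_fin invfM (invrK 2).
move: (fine _) => m le16.
rewrite ler_pdivrMr//.
have : h * 16^-1 <= h * (6 * (h^-1 * m)) by rewrite ler_pM2l//; lra.
have -> : h * (6 * (h^-1 * m)) = 6 * m by field.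
lra.
Qed.

Theorem theorem2p2 (R : realType) : ~ exists x : R, ap_derivable (@takagi R) x.
Proof.
move=> [x [d lim]].
have e0 : 0 < 32^-1 :> R by [].
have N0 : nbhs (0 : \bar R)%E [set z | (z < (96^-1)%:E)%E].
  by apply: open_nbhs_nbhs; split; [exact: open_ereal_lt_ereal|rewrite /= lte_fin].
have [r /= r0 small] := lim _ e0 _ N0.
(* The radius tested is [2 ^- n / 2], so that the window has length [2 ^- n]. *)
have [n _ /(_ n (leqnn n)) rn] := near_infty_natSinv_expn_lt (PosNum r0).
have h0 : 0 < 2 ^- n :> R by rewrite invr_gt0 exprn_gt0.
have := small (2 ^- n / 2).
rewrite /= sub0r normrN gtr0_norm ?divr_gt0//.
rewrite /= mul1r in rn.
have -> : 2 * (2 ^- n / 2) = 2 ^- n :> R by field.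
move=> /(_ ltac:(lra) isT).
(* Since [y != x], the denominator can be cleared. *)
rewrite [X in lebesgue_measure X](_ : _ = takagi_bad x d (2 ^- n / 2)); last first.
  congr (_ `&` _); apply/seteqP; split=> y /= [yx];
    by rewrite subr0 normrM normfV ler_pdivlMr// normr_gt0 subr_eq0.
apply/negP; rewrite -leNgt.
by rewrite inver gt_eqF// lee_pdivlMr// -EFinM mulrC takagi_bad_measure.
Qed.
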